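(* Let $q$ be an odd prime power, let $n\geq 1$, and let $m=q^n-1$. Suppose that $n>1$, or that $n=1$ and $q$ is not a prime. Then there exists an absolutely irreducible fixed-point subgroup of $\operatorname{Sp}_m(2)$ isomorphic to $\operatorname{AGL}_n(q)$.
   Context: $\operatorname{Sp}_m(2)$ is the symplectic group of a non-degenerate alternating form on $V=\mathbb{F}_2^m$. A subgroup $G\subseteq\operatorname{GL}(V)$ is a fixed-point subgroup if $\det(g-1)=0$ for all $g\in G$. $\operatorname{AGL}_n(q)=\mathbb{F}_q^n\rtimes\operatorname{GL}_n(q)$ is the affine general linear group. Absolutely irreducible means irreducible on $V\otimes_{\mathbb{F}_2}\overline{\mathbb{F}}_2$. *)

(* Defs.v *)
From HB Require Import structures.
From mathcomp Require Import all_boot all_order all_algebra all_fingroup.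
From mathcomp Require Import all_solvable all_field all_character.

Set Implicit Arguments.
Unset Strict Implicit.
Unset Printing Implicit Defensive.

Import GRing.Theory.
Local Open Scope ring_scope.

Definition prime_power (q : nat) : Prop :=
  exists p k : nat, [/\ prime p, (0 < k)%N & q = (p ^ k)%N].

Definition alternating_form (F : fieldType) (V : lmodType F)
    (f : {biscalar V}) : Prop :=
  forall v : V, f v v = 0.

Definition nondegenerate_form (F : fieldType) (V : lmodType F)
    (f : {biscalar V}) : Prop :=
  forall u : V, (forall v : V, f u v = 0) -> u = 0.

(* {'GL_m[F]} consists of matrices of size m.-1.+1, which is m for m > 0, so   *)
(* the natural module is 'rV_m.-1.+1, with matrices acting on the right. The   *)
(* index of GLrepr is shifted: GLrepr F k represents 'GL_k.+1[F].              *)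
Section SymplecticGroup.

Variables (m : nat) (f : {biscalar 'rV['F_2]_m.-1.+1}).

Definition Sp : {set {'GL_m(2)}} :=
  [set g : {'GL_m(2)} |
    [forall u : 'rV['F_2]_m.-1.+1, forall v : 'rV['F_2]_m.-1.+1,
       f (u *m GLval g) (v *m GLval g) == f u v]].

Lemma Sp_group_set : group_set Sp.
Proof.
apply/group_setP; split=> [|g h].
  by rewrite inE; apply/forallP=> u; apply/forallP=> v; rewrite !mulmx1.
rewrite !inE => /forallP Hg /forallP Hh.
apply/forallP=> u; apply/forallP=> v.
have -> : GLval (g * h)%g = GLval g *m GLval h by [].
have /forallP/(_ (v *m GLval g))/eqP := Hh (u *m GLval g).
by rewrite -!mulmxA => ->; have /forallP := Hg u.
Qed.

Canonical Sp_group := Group Sp_group_set.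

End SymplecticGroup.

Definition fixed_point (m : nat) (G : {set {'GL_m(2)}}) : Prop :=
  forall g : {'GL_m(2)}, g \in G -> \det (GLval g - 1%:M) = 0.

Definition F2bar : countClosedFieldType :=
  tag (countable_algebraic_closure 'F_2).

Definition F2_to_F2bar : {rmorphism 'F_2 -> F2bar} :=
  sval (tagged (countable_algebraic_closure 'F_2)).

Definition natural_repr (m : nat) (G : {group {'GL_m(2)}}) :
    mx_representation 'F_2 G m.-1.+1 :=
  subg_repr (GLrepr 'F_2 m.-1) (subsetT G).

(* The library's mx_absolutely_irreducible says that the enveloping algebra is *)
(* the full matrix algebra; here irreducibility is required after extending    *)
(* the scalars to an algebraic closure.                                        *)
Definition absolutely_irreducible (m : nat) (G : {group {'GL_m(2)}}) : Prop :=
  mx_irreducible (map_repr F2_to_F2bar (natural_repr G)).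

Definition AGL (n : nat) (F : finFieldType) : finGroupType :=
  sdprod_by ('MR (GLrepr F n.-1))%gact.

(* Main.v *)
Require Import Defs.
From HB Require Import structures.
From mathcomp Require Import all_boot all_order all_algebra all_fingroup.
From mathcomp Require Import all_solvable all_field all_character.


(** Let W = F_q^n. Since q^n is odd, F_2^W is the sum of the constants and of
    the module V of vectors of sum zero, on which the dot product is alternating
    and nondegenerate; AGL_n(q) acts faithfully on V by isometries.
    - Over an algebraic closure K, K^W has a basis of characters of the
      translation group W, and GL_n(q) permutes the nontrivial ones
      transitively, so V is absolutely irreducible.
    - An affine map g with a proper cycle on W fixes the indicator function of
      that cycle or of its complement, whichever has even size. A full cycle is
      impossible: its linear part would be unipotent, whence g^(p^e) = 1 as soon
      as p^e > n, and some p^e < q^n is that large unless n = 1 and q is prime.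
    - All nondegenerate alternating forms of a given dimension are isometric, so
      V can be identified with the given symplectic space. *)

Set Implicit Arguments.
Unset Strict Implicit.
Unset Printing Implicit Defensive.

Import GRing.Theory.
Local Open Scope ring_scope.

(** * Alternating forms over a field, as matrices *)

Section AlternatingMatrices.

Variable F : fieldType.

Definition alternating_mx n (M : 'M[F]_n) :=
  forall u : 'rV_n, u *m M *m u^T = 0.

Lemma trmx_alternating n (M : 'M[F]_n) : alternating_mx M -> M^T = - M.
Proof.
move=> altM; apply/matrixP=> i j; rewrite !mxE; apply/eqP.
have := altM (delta_mx 0 i + delta_mx 0 j).
rewrite !mulmxDl linearD /= !mulmxDr !altM add0r addr0 => /matrixP/(_ 0 0).
rewrite -!rowE !trmx_delta -!colE !mxE addrC => /eqP.
by rewrite addr_eq0.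
Qed.

Definition hyperbolic_mx : 'M[F]_(1 + 1) := block_mx 0 1 (-1) 0.

Lemma hyperbolic_mx_unit : hyperbolic_mx \in unitmx.
Proof.
suff: hyperbolic_mx *m (- hyperbolic_mx) = 1%:M by case/mulmx1_unit.
rewrite /hyperbolic_mx mulmxN mulmx_block !mulmx0 !mul0mx !mulmx1 !mul1mx.
rewrite !add0r !addr0 opp_block_mx !opprK !oppr0.
by rewrite -scalar_mx_block.
Qed.

(** A nonzero [u] orthogonal to the rows of [P] exists because [M *m P^T] has more rows than
    columns; invertibility of [M] then gives [w] pairing to 1 with [u]. *)
Lemma hyperbolic_pair_exists n d (M : 'M[F]_n) (P : 'M[F]_(d, n)) :
    alternating_mx M -> M \in unitmx -> P *m M *m P^T \in unitmx -> (d < n)%N ->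
  exists2 R : 'M_(1 + 1, n), P *m M *m R^T = 0 & R *m M *m R^T = hyperbolic_mx.
Proof.
move=> altM unitM unitA lt_dn; set A := P *m M *m P^T in unitA.
have [u u_neq0 uP0] : exists2 u : 'rV_n, u != 0 & u *m M *m P^T = 0.
  have: kermx (M *m P^T) != 0.
    by rewrite kermx_eq0 /row_free neq_ltn (leq_ltn_trans (rank_leq_col _)).
  case/rowV0Pn=> u /sub_kermxP uP0 u_neq0.
  by exists u; rewrite // -mulmxA.
have [w uw1] : exists w : 'rV_n, u *m M *m w^T = 1.
  have: u *m M != 0.
    by apply: contraNneq u_neq0 => uM0; rewrite -(mulmxK unitM u) uM0 mul0mx.
  case/rV0Pn=> k uMk; exists (((u *m M) 0 k)^-1 *: delta_mx 0 k).
  rewrite linearZ /= -scalemxAr trmx_delta -colE.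
  apply/matrixP=> i j; rewrite !mxE !ord1 /= mulrC.
  by rewrite mxE in uMk; rewrite divff.
(* Subtract from [w] its orthogonal projection to the row space of [P], whose Gram matrix is [A].
   The pairing with [u] does not change. *)
pose v := w - w *m M *m P^T *m invmx A *m P.
have vP0 : v *m M *m P^T = 0.
  rewrite !mulmxBl; set X := w *m M *m P^T.
  have -> : X *m invmx A *m P *m M *m P^T = X *m invmx A *m A.
    by rewrite /A !mulmxA.
  by rewrite mulmxKV // subrr.
have uv1 : u *m M *m v^T = 1.
  rewrite linearB /= mulmxBr uw1 [(_ *m P)^T]trmx_mul mulmxA uP0.
  by rewrite mul0mx subr0.
have sw (a b : nat) (X : 'M_(a, n)) (Y : 'M_(b, n)) :
    Y *m M *m X^T = - (X *m M *m Y^T)^T.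
  rewrite !trmx_mul trmxK (trmx_alternating altM).
  by rewrite mulNmx mulmxN opprK mulmxA.
exists (col_mx u v).
  by rewrite sw mul_col_mx mul_col_mx uP0 vP0 col_mx0 trmx0 oppr0.
rewrite mul_col_mx tr_col_mx mul_col_row !altM uv1 sw uv1.
by rewrite /hyperbolic_mx [1^T]trmx1.
Qed.

(* Grow two families with equal invertible Gram matrices, one hyperbolic pair *)
(* at a time.                                                                 *)
Lemma alternating_mx_isometric n (M N : 'M[F]_n) :
    alternating_mx M -> M \in unitmx -> alternating_mx N -> N \in unitmx ->
  exists P : 'M_n, P *m M *m P^T = N.
Proof.
move=> altM unitM altN unitN.
suff [d [P [Q [ge_dn unitP PQ]]]] : exists d (P Q : 'M[F]_(d, n)),
    [/\ (n <= d)%N, P *m M *m P^T \in unitmx & P *m M *m P^T = Q *m N *m Q^T].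
  have rankP : (d <= n)%N.
    rewrite -row_free_unit in unitP; rewrite -[X in (X <= _)%N](eqP unitP).
    by rewrite -mulmxA (leq_trans (mxrankM_maxl _ _)) ?rank_leq_col.
  have dn : d = n by apply/eqP; rewrite eqn_leq rankP.
  subst d; have unitQ : Q \in unitmx.
    by move: unitP; rewrite PQ !unitmx_mul => /andP[/andP[]].
  exists (invmx Q *m P); rewrite trmx_mul !mulmxA -2!(mulmxA (invmx Q)).
  rewrite PQ -!mulmxA -trmx_mul mulVmx // trmx1 mulmx1.
  by rewrite mulmxA mulVmx // mul1mx.
have: exists d (P Q : 'M[F]_(d, n)),
    [/\ (n - d <= n)%N, P *m M *m P^T \in unitmx
      & P *m M *m P^T = Q *m N *m Q^T].
  exists 0, 0, 0; rewrite leq_subr; split=> //; last by rewrite !mul0mx.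
  by rewrite unitmxE det_mx00 unitr1.
have: forall k, (exists d (P Q : 'M[F]_(d, n)),
    [/\ (n - d <= k)%N, P *m M *m P^T \in unitmx
      & P *m M *m P^T = Q *m N *m Q^T]) -> exists d (P Q : 'M[F]_(d, n)),
    [/\ (n <= d)%N, P *m M *m P^T \in unitmx & P *m M *m P^T = Q *m N *m Q^T];
  last by apply.
elim=> [|k IHk] [d [P [Q [le_k unitP PQ]]]].
  by exists d, P, Q; rewrite -subn_eq0 -leqn0 le_k.
have [le_nd | lt_dn] := leqP n d; first by exists d, P, Q.
have [R PR RR] := hyperbolic_pair_exists altM unitM unitP lt_dn.
rewrite PQ in unitP.
have [S QS SS] := hyperbolic_pair_exists altN unitN unitP lt_dn.
have gram (X : 'M[F]_n) (Y : 'M_(d, n)) (Z : 'M_(1 + 1, n)) :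
    alternating_mx X -> Y *m X *m Z^T = 0 -> Z *m X *m Z^T = hyperbolic_mx ->
  col_mx Y Z *m X *m (col_mx Y Z)^T
    = block_mx (Y *m X *m Y^T) 0 0 hyperbolic_mx.
  move=> altX YZ0 ZZ; rewrite mul_col_mx tr_col_mx mul_col_row YZ0 ZZ.
  congr (block_mx _ _ _ _); apply: trmx_inj; rewrite !trmx_mul trmxK trmx0.
  by rewrite (trmx_alternating altX) mulNmx mulmxN mulmxA YZ0 oppr0.
apply: IHk; exists (d + (1 + 1))%N, (col_mx P R), (col_mx Q S).
rewrite !gram // PQ; split=> //.
  by rewrite subnDA leq_subLR (leq_trans le_k) // leqnSn.
by rewrite unitmxE det_ublock unitrM -!unitmxE unitP hyperbolic_mx_unit.
Qed.

End AlternatingMatrices.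

(** * Permutation action on functions, written as row vectors *)

Section PermutationModule.

Variable T : finType.

Fact ord_perm_inj (s : {perm T}) :
  injective (fun i : 'I_#|T| => enum_rank (s (enum_val i))).
Proof. by move=> i j /enum_rank_inj/perm_inj/enum_val_inj. Qed.

Definition ord_perm (s : {perm T}) : 'S_#|T| := perm (@ord_perm_inj s).

Lemma ord_permE s i : ord_perm s i = enum_rank (s (enum_val i)).
Proof. exact: permE. Qed.

Lemma ord_permM s t : ord_perm (s * t) = (ord_perm s * ord_perm t)%g.
Proof. by apply/permP=> i; rewrite permM !ord_permE enum_rankK permM. Qed.

Lemma ord_perm1 : ord_perm 1 = 1%g.
Proof. by apply/permP=> i; rewrite ord_permE !perm1 enum_valK. Qed.

Variable R : pzRingType.

Definition row_of (h : T -> R) : 'rV[R]_#|T| := \row_i h (enum_val i).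

Lemma row_of_ext h k : h =1 k -> row_of h = row_of k.
Proof. by move=> eq_hk; apply/rowP=> i; rewrite !mxE. Qed.

Lemma row_ofK (v : 'rV[R]_#|T|) : row_of (fun x => v 0 (enum_rank x)) = v.
Proof. by apply/rowP=> i; rewrite mxE enum_valK. Qed.

Lemma row_of_perm h s :
  row_of h *m perm_mx (ord_perm s) = row_of (fun x => h ((s^-1)%g x)).
Proof.
have -> : ord_perm s = (ord_perm s^-1)^-1%g.
  by apply/eqP; rewrite eq_sym eq_invg_mul -ord_permM mulVg ord_perm1.
rewrite -col_permE; apply/rowP=> i.
by rewrite !mxE ord_permE enum_rankK.
Qed.

Lemma row_of_mul1 h :
  row_of h *m const_mx 1 = (\sum_x h x)%:M :> 'M_1.
Proof.
apply/matrixP=> i j; rewrite !mxE !ord1 mulr1n.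
rewrite (reindex (@enum_rank T)) /=; last exact: onW_bij (enum_rank_bij T).
by apply: eq_bigr => x _; rewrite !mxE mulr1 enum_rankK.
Qed.

End PermutationModule.

(** * The affine group as permutations of the vector space *)

Section AffineAction.

Variables (F : finFieldType) (n' : nat).
Local Notation n := n'.+1.
Local Notation W := 'rV[F]_n.

Definition affine_map (g : AGL n F) (w : W) : W := w *m GLval g.1 + g.2.

Lemma affine_mapM g h w :
  affine_map (g * h)%g w = affine_map h (affine_map g w).
Proof.
rewrite /affine_map /= mulmxDl -mulmxA addrA.
by rewrite mx_repr_actE ?inE.
Qed.

Lemma affine_map1 w : affine_map 1%g w = w.
Proof. by rewrite /affine_map /= mulmx1 addr0. Qed.

Lemma affine_map_inj g : injective (affine_map g).
Proof.
apply: can_inj (affine_map g^-1%g) _ => w.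
by rewrite -affine_mapM mulgV affine_map1.
Qed.

Definition affine_perm g : {perm W} := perm (@affine_map_inj g).

Lemma affine_permE g w : affine_perm g w = affine_map g w.
Proof. exact: permE. Qed.

Lemma affine_permM g h :
  affine_perm (g * h)%g = (affine_perm g * affine_perm h)%g.
Proof. by apply/permP=> w; rewrite permM !affine_permE affine_mapM. Qed.

Fact affine_elt_proof (a : {'GL_n[F]}) (t : W) :
  (a, t) \in setX 'GL_n[F]%g [set: W].
Proof. by rewrite !inE. Qed.

Definition affine_elt a t : AGL n F :=
  SdPair ('MR (GLrepr F n'))%gact (affine_elt_proof a t).

Lemma affine_eltE a t w : affine_map (affine_elt a t) w = w *m GLval a + t.
Proof. by []. Qed.

Lemma affine_perm_inj : injective affine_perm.
Proof.
move=> g h /permP eq_gh; apply: val_inj => /=.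
have eq_t : g.2 = h.2.
  by have := eq_gh 0; rewrite !affine_permE /affine_map !mul0mx !add0r.
rewrite (surjective_pairing (val g)) (surjective_pairing (val h)) /=.
congr (_, _) => //; apply: val_inj; apply/row_matrixP=> i /=.
have := eq_gh (delta_mx 0 i); rewrite !affine_permE /affine_map eq_t -!rowE.
by apply: addIr.
Qed.

End AffineAction.

(** * Fourier analysis on the translation group *)

Section Fourier.

Variables (F : finFieldType) (n' : nat) (K : fieldType).
Local Notation n := n'.+1.
Local Notation W := 'rV[F]_n.

Variable chi : F -> K.
Hypothesis chi0 : chi 0 = 1.
Hypothesis chiD : forall a b, chi (a + b) = chi a * chi b.
Hypothesis chi_neq1 : exists c, chi c != 1.
Hypothesis cardW : #|{: W}|%:R = 1 :> K.

Let dot (u v : W) : F := (u *m v^T) 0 0.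

Let dotC u v : dot u v = dot v u.
Proof. by rewrite /dot -[v in RHS]trmxK -trmx_mul [in RHS]mxE. Qed.

Let dotDl u v w : dot (u + v) w = dot u w + dot v w.
Proof. by rewrite /dot mulmxDl mxE. Qed.

Let dotNl u w : dot (- u) w = - dot u w.
Proof. by rewrite /dot mulNmx mxE. Qed.

(** Orthogonality of characters: for nonzero [y], translating [w] by a suitable [w0] multiplies the
    sum by some [chi c] different from 1. *)
Let sum_chi y : \sum_w chi (dot w y) = (y == 0)%:R.
Proof.
have [-> | /rV0Pn[k yk]] := eqVneq.
  rewrite (eq_bigr (fun _ => 1)) ?sumr_const // => w _.
  by rewrite /dot trmx0 mulmx0 mxE chi0.
have [c chi_c] := chi_neq1; pose w0 : W := (c / y 0 k) *: delta_mx 0 k.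
have w0y : dot w0 y = c.
  by rewrite /dot -scalemxAl -rowE !mxE divfK.
apply/eqP; set S := \sum_w _.
have: S = chi c * S.
  rewrite {1}/S (reindex_inj (addrI w0)) big_distrr /=.
  by apply: eq_bigr => w _; rewrite dotDl chiD w0y.
move/eqP; rewrite -{1}[S]mul1r -subr_eq0 -mulrBl mulf_eq0 subr_eq0 eq_sym.
by rewrite (negPf chi_c).
Qed.

Let psi y : 'rV[K]_#|{: W}| := row_of (fun w => chi (dot w y)).
(** Fourier coefficients; no factor [1 / #|W|] appears, since [#|W|] is 1 in [K]. *)
Let coef (h : W -> K) y := \sum_s h s * chi (- dot s y).

Let inversion h : row_of h = \sum_y coef h y *: psi y.
Proof.
apply/rowP=> i; rewrite summxE mxE; set w := enum_val i.
under eq_bigr do rewrite !mxE big_distrl /=.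
rewrite exchange_big /= (bigD1 w) //= [X in _ + X]big1 => [|s s_neq_w].
  rewrite addr0; under eq_bigr do rewrite -mulrA -chiD addNr chi0 mulr1.
  by rewrite sumr_const -[h w in RHS]mulr1 -mulrnAr cardW mulr1.
under eq_bigr => y _ do rewrite -mulrA -chiD -dotNl -dotDl dotC.
by rewrite -big_distrr /= sum_chi addrC subr_eq0 eq_sym (negPf s_neq_w) mulr0.
Qed.

Let unit_transitive (y z : W) : y != 0 -> z != 0 ->
  exists2 b : 'M[F]_n, b \in unitmx & y *m b = z.
Proof.
move=> y_neq0 z_neq0; have [k yk] := rV0Pn _ y_neq0.
(* A rank-one matrix sending [y] to [z]; its restriction to the line of [y] extends to an invertible
   matrix. *)
pose f : 'M_n := delta_mx k 0 *m ((y 0 k)^-1 *: z).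
have yf : y *m f = z.
  rewrite /f mulmxA -colE -scalemxAr; apply/rowP=> j.
  by rewrite !mxE big_ord1 !mxE mulKf.
have [|b unit_b yb] := @complete_unitmx _ _ _ y f.
  by rewrite yf !rank_rV y_neq0 z_neq0.
by exists b; rewrite // -yb.
Qed.

(* A nonzero invariant subspace contains some nontrivial character of [W],    *)
(* hence its whole orbit under the linear group, and these characters span    *)
(* the vectors of sum zero.                                                   *)
Lemma affine_invariant_full r (U : 'M[K]_(r, #|{: W}|)) :
    (forall g, U *m perm_mx (ord_perm (affine_perm g)) <= U)%MS ->
    U *m const_mx 1 = 0 :> 'cV_r -> U != 0 ->
  forall v : 'rV_#|{: W}|, v *m const_mx 1 = 0 :> 'M_1 -> (v <= U)%MS.
Proof.
move=> stabU sumU nzU v sumv.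
have stab (u : 'rV_ #|{: W}|) g :
    (u <= U)%MS -> (u *m perm_mx (ord_perm (affine_perm g)) <= U)%MS.
  by move=> uU; apply: submx_trans (stabU g); apply: submxMr.
have coef0 (u : 'rV_ #|{: W}|) : u *m const_mx 1 = 0 :> 'M_1 ->
    coef (fun x => u 0 (enum_rank x)) 0 = 0.
  rewrite -{1}[u]row_ofK row_of_mul1 => /matrixP/(_ 0 0); rewrite !mxE mulr1n.
  move=> sum0; rewrite /coef -[RHS]sum0; apply: eq_bigr => s _.
  by rewrite /dot trmx0 mulmx0 mxE oppr0 chi0 mulr1.
have [y y_neq0 psi_y] : exists2 y, y != 0 & (psi y <= U)%MS.
  have [u uU u_neq0] := rowV0Pn nzU.
  have sumu : u *m const_mx 1 = 0 :> 'M_1.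
    by have [D ->] := submxP uU; rewrite -mulmxA sumU mulmx0.
  pose h x := u 0 (enum_rank x).
  have [y cy] : exists y, coef h y != 0.
    apply/existsP; apply: contraNT u_neq0 => /existsPn coef_h0.
    rewrite -[u]row_ofK inversion big1 // => y _.
    by have := coef_h0 y; rewrite negbK => /eqP ->; rewrite scale0r.
  exists y; first by apply: contraNneq cy => ->; rewrite coef0.
  suff: (coef h y *: psi y <= U)%MS by rewrite eqmx_scale.
  (* Summing the translates of [u] with weights [chi (dot t y)] isolates its [psi y] component;
     substitute [t = w - s]. *)
  have -> : coef h y *: psi y = \sum_t chi (dot t y) *:
      (u *m perm_mx (ord_perm (affine_perm (affine_elt 1%g t)))).
    apply/rowP=> i; rewrite summxE !mxE; set w := enum_val i.
    rewrite [RHS](reindex_inj (inj_comp (addrI w) oppr_inj)) /=.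
    rewrite /coef big_distrl /=; apply: eq_bigr => s _.
    rewrite -{1}[u]row_ofK row_of_perm !mxE -/w -/(h _).
    have -> : (affine_perm (affine_elt 1%g (w - s)))^-1%g w = s.
      apply: (canLR (permK _)).
      by rewrite affine_permE affine_eltE mulmx1 addrC subrK.
    by rewrite dotDl dotNl chiD -mulrA mulrC; congr (_ * _); rewrite mulrC.
  by apply: summx_sub => t _; apply: scalemx_sub; apply: stab.
have psi_all z : z != 0 -> (psi z <= U)%MS.
  move=> z_neq0; have [b unit_b yb] := unit_transitive z_neq0 y_neq0.
  (* The transpose is the adjoint for [dot]: moving the argument by [b^T] turns [psi y], with
     [y = z *m b], into [psi z]. *)
  have unit_bT : b^T \is a GRing.unit by rewrite -[_ \is a _]unitmx_tr trmxK.
  pose a : {'GL_n[F]} := FinRing.Unit unit_bT.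
  suff -> : psi z = psi y *m perm_mx (ord_perm (affine_perm (affine_elt a 0))).
    exact: stab.
  rewrite row_of_perm; apply: row_of_ext => w.
  set x := fun_of_perm _ w.
  have -> : w = x *m b^T.
    rewrite -[LHS](permKV (affine_perm (affine_elt a 0))) -/x.
    by rewrite affine_permE affine_eltE addr0.
  by rewrite /dot -yb trmx_mul !mulmxA.
rewrite -[v]row_ofK inversion; apply: summx_sub => z _.
have [-> | z_neq0] := eqVneq z 0; first by rewrite coef0 // scale0r sub0mx.
by apply: scalemx_sub; apply: psi_all.
Qed.

End Fourier.

(** A root [z] of [1 + X + ... + X^(p-1)] is a [p]-th root of unity, and [z] is not 1 because [p] is
    nonzero in [K]. The character raises [z] to an ['F_p]-linear functional that is nonzero at 1. *)
Lemma additive_character_exists (F : finFieldType) (p : nat)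
    (K : closedFieldType) :
    p \in [pchar F] -> p%:R != 0 :> K ->
  exists chi : F -> K,
    [/\ chi 0 = 1, forall a b, chi (a + b) = chi a * chi b
      & exists c, chi c != 1].
Proof.
move=> charFp p_neq0; have pr_p := pcharf_prime charFp.
have [z rootz] : exists z : K, root (\poly_(i < p) 1) z.
  apply/closed_rootP; rewrite size_poly_eq ?oner_neq0 //.
  by rewrite neq_ltn prime_gt1 ?orbT.
have sumz : \sum_(i < p) z ^+ i = 0.
  move/eqP: rootz; rewrite horner_poly => sum0; rewrite -[RHS]sum0.
  by apply: eq_bigr => i _; rewrite mul1r.
have zp1 : z ^+ p = 1 by apply/eqP; rewrite -subr_eq0 subrX1 sumz mulr0.
have z_neq1 : z != 1.
  apply: contraNneq p_neq0 => z1; rewrite -sumz z1.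
  under eq_bigr do rewrite expr1n.
  by rewrite sumr_const card_ord.
pose L : vectType 'F_p := pPrimeCharType charFp.
have [i ci_neq0] : exists i, coord (vbasis {:L}) i (1 : F) != 0.
  apply/existsP; apply: contraT => /existsPn coord0.
  have /eqP[] := oner_neq0 F; rewrite [LHS](coord_vbasis (memvf (1 : L))).
  by rewrite big1 // => j _; have /eqP -> := negbNE (coord0 j); rewrite scale0r.
pose phi (x : L) : 'F_p := coord (vbasis {:L}) i x.
exists (fun x => z ^+ (phi x : nat)); split.
- by rewrite /phi linear0.
- move=> a b; rewrite /phi linearD -exprD /= expr_mod //.
  by rewrite Fp_cast.
exists ((phi (1 : F))^-1 *: (1 : L)).
have -> : phi ((phi (1 : F))^-1 *: (1 : L)) = 1.
  by rewrite /phi linearZ; apply: mulVf.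
by rewrite expr1.
Qed.

(** * Unipotent matrices in characteristic [p] *)

Section UnipotentPolynomials.

Variables (F : fieldType) (p : nat).
Hypothesis charFp : p \in [pchar F].

Lemma XsubC1_expr_pchar e : ('X - 1%:P) ^+ (p ^ e) = 'X^(p ^ e) - 1 :> {poly F}.
Proof.
have char_nat : [pchar {poly F}].-nat (p ^ e)%N.
  have charXp : p \in [pchar {poly F}] by rewrite pchar_poly.
  rewrite (eq_pnat _ (pcharf_eq charXp)) pnatX pnat_id //.
  exact: pcharf_prime charXp.
by rewrite exprDn_pchar // exprNn_pchar // polyC1 expr1n.
Qed.

Lemma sum_expr_pchar e :
  \sum_(i < p ^ e) 'X^i = ('X - 1%:P) ^+ (p ^ e).-1 :> {poly F}.
Proof.
apply: (mulfI (negbT (polyXsubC_eq0 (1 : F)))).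
rewrite -exprS prednK ?expn_gt0 ?prime_gt0 ?(pcharf_prime charFp) //.
by rewrite XsubC1_expr_pchar polyC1 subrX1.
Qed.

(** The minimal polynomial divides [(X - 1)^(p^e)], so it is a power of [X - 1], of degree at most
    that of the characteristic polynomial. *)
Lemma unipotent_exprn n' (A : 'M[F]_n'.+1) e d :
  A ^+ (p ^ e) = 1 -> (n' < d)%N -> horner_mx A (('X - 1%:P) ^+ d) = 0.
Proof.
move=> Ape1 ge_dn.
have: mxminpoly A %| ('X - 1%:P) ^+ (p ^ e).
  apply: mxminpoly_min; rewrite XsubC1_expr_pchar rmorphB rmorphXn /=.
  by rewrite horner_mx_X Ape1 rmorph1 subrr.
case/dvdp_exp_XsubCP=> k _ minA; apply: mxminpoly_minP.
rewrite (eqp_dvdl _ minA) dvdp_exp2l //.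
apply: leq_trans ge_dn; rewrite -ltnS -[k.+1](size_exp_XsubC k (1 : F)).
rewrite -(eqp_size minA) -(size_char_poly A) dvdp_leq ?mxminpoly_dvd_char //.
by rewrite monic_neq0 ?char_poly_monic.
Qed.

End UnipotentPolynomials.

(** The first [#|porbit s x|] iterates are distinct, so entries 0 and [k] cannot coincide among
    them. *)
Lemma card_porbit_leq (T : finType) (s : {perm T}) x k :
  (0 < k)%N -> iter k s x = x -> (#|porbit s x| <= k)%N.
Proof.
move=> k_gt0 skx; rewrite leqNgt; apply/negP=> lt_k.
have := nth_uniq x _ _ (uniq_traject_porbit s x); rewrite !size_traject.
move/(_ k 0 lt_k (leq_ltn_trans (leq0n _) lt_k)).
by rewrite !nth_traject ?(leq_ltn_trans (leq0n _) lt_k) //= skx eqxx gtn_eqF.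
Qed.

(** * Affine maps are not full cycles *)

Section NoFullCycle.

Variables (F : finFieldType) (n' : nat).
Local Notation n := n'.+1.

Lemma iter_affine_perm (g : AGL n F) j w :
  iter j (affine_perm g) w
    = w *m GLval g.1 ^+ j + g.2 *m \sum_(i < j) GLval g.1 ^+ i.
Proof.
elim: j => [|j IHj]; first by rewrite big_ord0 mulmx0 addr0 mulmx1.
rewrite iterS IHj affine_permE /affine_map mulmxDl -!mulmxA -addrA exprSr.
congr (_ + _); rewrite big_ord_recl addrC mulmxDr mulmx1; congr (_ + _ *m _).
by rewrite mulmx_suml; apply: eq_bigr => i _; rewrite exprSr.
Qed.

(* The linear part [A] of a full cycle has [p]-power order, so that           *)
(* [(A - 1) ^+ n = 0]; then [1 + A + ... + A ^+ (p ^ e - 1)], which equals    *)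
(* [(A - 1) ^+ (p ^ e - 1)], vanishes already for some [p ^ e < #|F| ^ n].    *)
Lemma affine_perm_not_transitive p k (g : AGL n F) :
    prime p -> odd p -> #|F| = (p ^ k)%N -> (1 < k * n)%N ->
  exists w, w \notin porbit (affine_perm g) 0.
Proof.
move=> pr_p odd_p cardF kn_gt1; apply/existsP; rewrite -negb_forall.
apply/negP=> /forallP full.
have charF : p \in [pchar F] by apply: card_finPcharP cardF pr_p.
pose s := affine_perm g; pose A : 'M[F]_n := GLval g.1.
have porbitT w : porbit s w = [set: 'rV[F]_n].
  have /eqP -> : porbit s w == porbit s 0 by rewrite eq_porbit_mem full.
  by apply/setP=> x; rewrite full inE.
have cardW w : #|porbit s w| = (p ^ (k * n))%N.
  by rewrite porbitT cardsT card_mx mul1n cardF expnM.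
(* Evaluation at 0 shows that the translation part of this iterate vanishes; the basis vectors then
   give the rows of the power of [A]. *)
have ApN : A ^+ (p ^ (k * n)) = 1.
  have fixN w : iter (p ^ (k * n)) s w = w by rewrite -(cardW w) iter_porbit.
  have := fixN 0; rewrite iter_affine_perm mul0mx add0r => sum0.
  apply/row_matrixP=> i; rewrite !rowE mulmx1.
  by have := fixN (delta_mx 0 i); rewrite iter_affine_perm sum0 addr0.
(* The largest exponent with [p ^ e < #|F| ^ n]. As [p >= 3] and [k * n > 1], already
   [k * n < p ^ e]. *)
pose e := (k * n).-1.
have lt_npe : (n < p ^ e)%N.
  have p_gt2 : (2 < p)%N by apply: odd_prime_gt2.
  have exp_gt m : (m.+2 < p ^ m.+1)%N.
    elim: m => [|m IHm]; first by rewrite expn1.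
    rewrite expnS (leq_ltn_trans IHm) //.
    by rewrite ltn_Pmull ?prime_gt1 // expn_gt0 prime_gt0.
  have k_gt0 : (0 < k)%N by case: (k) kn_gt1.
  apply: leq_ltn_trans (leq_pmull n k_gt0) _; rewrite /e.
  by case: (k * n)%N kn_gt1 => [|[|m]].
have: iter (p ^ e) s 0 = 0.
  rewrite iter_affine_perm mul0mx add0r -/A.
  have -> : \sum_(i < p ^ e) A ^+ i = horner_mx A (\sum_(i < p ^ e) 'X^i).
    rewrite rmorph_sum; apply: eq_bigr => i _.
    by rewrite rmorphXn /= horner_mx_X.
  rewrite sum_expr_pchar // (unipotent_exprn charF ApN) ?mulmx0 //.
  by rewrite -ltnS prednK // (leq_trans _ lt_npe).
move/(card_porbit_leq (leq_ltn_trans (leq0n _) lt_npe)).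
by rewrite cardW leq_exp2l ?prime_gt1 // leqNgt ltn_predL (ltnW kn_gt1).
Qed.

End NoFullCycle.

(** * Gram matrices and bases of the sum-zero space *)

Lemma biscalar_mxE (F : fieldType) n (f : {biscalar 'rV[F]_n}) :
  exists M : 'M_n, forall u v, f u v = (u *m M *m v^T) 0 0.
Proof.
exists (\matrix_(i, j) f (delta_mx 0 i) (delta_mx 0 j)) => u v.
rewrite {1}[v]row_sum_delta linear_sumr mxE; apply: eq_bigr => j _.
rewrite linearZr_LR /= mulrC [v^T _ _]mxE; congr (_ * _).
rewrite {1}[u]row_sum_delta linear_sumlz mxE; apply: eq_bigr => i _.
by rewrite linearZl_LR /= mxE.
Qed.

Section SumZero.

Variables (K : fieldType) (d N : nat) (B : 'M[K]_(d, N)).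
Hypothesis sumB : B *m const_mx 1 = 0 :> 'cV_d.
Hypothesis gramB : B *m B^T \in unitmx.
Hypothesis eqN : N = d.+1.

(** A right inverse of [B]: it maps a sum-zero vector to its coordinates in the rows of [B]. *)
Definition sum_zero_coord : 'M[K]_(N, d) := B^T *m invmx (B *m B^T).

Lemma sum_zero_coordK : B *m sum_zero_coord = 1%:M.
Proof. by rewrite mulmxA mulmxV. Qed.

(** The [d] independent rows of [B] lie in the sum-zero hyperplane, of dimension [N - 1 = d], hence
    span it. *)
Lemma sum_zeroK r (v : 'M[K]_(r, N)) :
  v *m const_mx 1 = 0 :> 'cV_r -> v *m sum_zero_coord *m B = v.
Proof.
move=> sumv.
have rankB : \rank B = d.
  apply/eqP; rewrite eqn_leq rank_leq_row -{1}(mxrank1 K d) -sum_zero_coordK.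
  exact: mxrankM_maxl.
have leB : (B <= kermx (const_mx 1 : 'cV[K]_N))%MS by apply/sub_kermxP.
have: (kermx (const_mx 1 : 'cV[K]_N) <= B)%MS.
  rewrite -(geq_leqif (mxrank_leqif_sup leB)) rankB mxrank_ker.
  have -> : \rank (const_mx 1 : 'cV[K]_N) = 1%N.
    rewrite -mxrank_tr rank_rV trmx_const; case: eqP => // /rowP; rewrite eqN.
    by move/(_ ord0)/eqP; rewrite !mxE oner_eq0.
  by rewrite eqN subn1.
move/(submx_trans (introT sub_kermxP sumv)) => /submxP[x ->].
by rewrite -(mulmxA x) sum_zero_coordK mulmx1.
Qed.

End SumZero.

Lemma pchar_F2 : 2 \in [pchar 'F_2].
Proof. exact: pchar_Fp. Qed.

(* The rows of [row_mx 1 1] span the vectors of sum zero, with Gram matrix    *)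
(* [1 + J], an involution because [J ^ 2 = d J = 0].                          *)
Lemma sum_zero_gram d N (M : 'M['F_2]_d) :
    N = d.+1 -> odd N -> alternating_mx M -> M \in unitmx ->
  exists2 B : 'M['F_2]_(d, N), B *m const_mx 1 = 0 :> 'cV_d & B *m B^T = M.
Proof.
rewrite -addn1 => -> odd_d altM unitM; rewrite oddD addbT in odd_d.
have addrr2 r s (X : 'M['F_2]_(r, s)) : X + X = 0.
  by apply/matrixP=> i j; rewrite !mxE (addrr_pchar2 pchar_F2).
pose J : 'M['F_2]_d := const_mx 1.
pose B : 'M['F_2]_(d, d + 1) := row_mx 1%:M (const_mx 1).
have gramB : B *m B^T = 1%:M + J.
  rewrite tr_row_mx mul_row_col trmx1 mulmx1 trmx_const; congr (_ + _).
  by apply/matrixP=> i j; rewrite !mxE big_ord1 !mxE mulr1.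
have sumB : B *m const_mx 1 = 0 :> 'cV_d.
  rewrite -[const_mx 1]col_mx_const mul_row_col mul1mx.
  rewrite [_ *m _](_ : _ = const_mx 1) ?addrr2 //.
  by apply/matrixP=> i j; rewrite !mxE big_ord1 !mxE mulr1.
have unitB : B *m B^T \in unitmx.
  suff: B *m B^T *m (B *m B^T) = 1%:M by case/mulmx1_unit.
  rewrite gramB mulmxDl mul1mx mulmxDr mulmx1 -addrA [J + _]addrA addrr2 add0r.
  suff -> : J *m J = 0 by rewrite addr0.
  apply/matrixP=> i j; rewrite !mxE.
  under eq_bigr do rewrite !mxE mulr1.
  rewrite sumr_const card_ord; apply/eqP.
  by rewrite -(dvdn_pcharf pchar_F2) dvdn2.
(* Since [x^2 = x] in ['F_2], the dot product of a vector with itself is its coordinate sum. *)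
have altB : alternating_mx (B *m B^T).
  move=> u; rewrite mulmxA -mulmxA -trmx_mul.
  have sum0 : u *m B *m const_mx 1 = 0 :> 'M_1 by rewrite -mulmxA sumB mulmx0.
  rewrite -[RHS]sum0; apply/matrixP=> i j; rewrite !ord1 !mxE.
  apply: eq_bigr => k _; rewrite [_^T k 0]mxE [const_mx _ k 0]mxE mulr1.
  by case: ((u *m B) 0 k) => [[|[|]]] // lt2; apply: val_inj.
have [P PBP] := alternating_mx_isometric altB unitB altM unitM.
exists (P *m B); first by rewrite -mulmxA sumB mulmx0.
by rewrite trmx_mul -PBP !mulmxA.
Qed.

(** * The affine group acting on sum-zero vectors *)

Section DeletedPermutationModule.

Variables (F : finFieldType) (n' m : nat).
Local Notation n := n'.+1.
Local Notation W := 'rV[F]_n.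
Local Notation d := m.-1.+1.

Variable B : 'M['F_2]_(d, #|{: W}|).
Hypothesis sumB : B *m const_mx 1 = 0 :> 'cV_d.
Hypothesis gramB : B *m B^T \in unitmx.
Hypothesis cardW : #|{: W}| = d.+1.
Hypothesis oddW : odd #|{: W}|.

Local Notation C := (sum_zero_coord B).
Local Notation perm_mx_of g := (perm_mx (ord_perm (affine_perm g))).

Definition deleted_mx (g : AGL n F) : 'M['F_2]_d := B *m perm_mx_of g *m C.

Lemma deleted_mxE g : deleted_mx g *m B = B *m perm_mx_of g.
Proof.
apply: sum_zeroK => //; rewrite -mulmxA -row_permE.
rewrite [row_perm _ _](_ : _ = const_mx 1) //.
by apply/matrixP=> i j; rewrite !mxE.
Qed.

Lemma deleted_mxM g h : deleted_mx (g * h)%g = deleted_mx g *m deleted_mx h.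
Proof.
rewrite {3}/deleted_mx !mulmxA deleted_mxE /deleted_mx affine_permM ord_permM.
by rewrite perm_mxM !mulmxA.
Qed.

Lemma deleted_mx1 : deleted_mx 1%g = 1%:M.
Proof.
rewrite /deleted_mx (_ : affine_perm 1 = 1%g) ?ord_perm1 ?perm_mx1 ?mulmx1.
  exact: sum_zero_coordK.
by apply/permP=> w; rewrite affine_permE affine_map1 perm1.
Qed.

Fact deleted_mx_unit g : deleted_mx g \is a GRing.unit.
Proof.
have: deleted_mx g *m deleted_mx g^-1%g = 1%:M.
  by rewrite -deleted_mxM mulgV deleted_mx1.
by case/mulmx1_unit=> unit_g _; exact: unit_g.
Qed.

Definition deleted_repr g : {'GL_m(2)} := FinRing.Unit (deleted_mx_unit g).

Lemma deleted_reprM :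
  {in [set: AGL n F] &, {morph deleted_repr : g h / (g * h)%g}}.
Proof. by move=> g h _ _; apply: val_inj; apply: deleted_mxM. Qed.

Canonical deleted_morphism := Morphism deleted_reprM.

Definition deleted_group : {group {'GL_m(2)}} :=
  (deleted_morphism @* [set: AGL n F])%G.

Lemma deleted_groupP x :
  reflect (exists g, x = deleted_repr g) (x \in deleted_group).
Proof.
apply: (iffP morphimP) => [[g _ _ ->] | [g ->]]; first by exists g.
by exists g; rewrite ?inE.
Qed.

(** Passage between coordinates and functions on [W], where fixed vectors are visible. *)
Lemma deleted_mx_fixed g (v : 'rV['F_2]_#|{: W}|) :
    v *m const_mx 1 = 0 :> 'M_1 ->
  (v *m C *m deleted_mx g == v *m C) = (v *m perm_mx_of g == v).
Proof.
move=> sumv; apply/eqP/eqP => fix_v.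
  transitivity (v *m C *m (deleted_mx g *m B)).
    by rewrite deleted_mxE mulmxA sum_zeroK.
  by rewrite mulmxA fix_v sum_zeroK.
by rewrite /deleted_mx mulmxA (mulmxA _ B) sum_zeroK // fix_v.
Qed.

(** If [g] moves [w] to [z], a third point [x] exists because [#|W|] is odd. The difference of the
    indicators of [w] and [x] vanishes at [z], but its image under [g] is 1 there. *)
Lemma deleted_repr_inj : ('injm deleted_morphism)%g.
Proof.
apply/subsetP=> g /morphpreP[_ /set1P/(congr1 val)/= g1].
apply/set1P; apply: affine_perm_inj; apply/permP=> w.
rewrite !affine_permE affine_map1; set z := affine_map g w.
apply/eqP; apply: contraT => z_neq_w.
have [x x_wz] : exists x, x \notin [set w; z].
  apply/existsP; rewrite -negb_forall; apply: contraTN (oddW) => /forallP inWZ.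
  have -> : #|{: W}| = #|[set w; z]| by apply: eq_card => x; rewrite inWZ.
  by rewrite cards2 eq_sym z_neq_w.
rewrite !inE negb_or in x_wz; have [x_neq_w x_neq_z] := andP x_wz.
pose h y : 'F_2 := (y == w)%:R - (y == x)%:R.
have sumh : row_of h *m const_mx 1 = 0 :> 'M_1.
  rewrite row_of_mul1 sumrB.
  rewrite (bigD1 w) //= eqxx big1 => [|y /negPf-> //].
  rewrite (bigD1 x) //= eqxx big1 => [|y /negPf-> //].
  by rewrite subrr raddf0.
have: row_of h *m C *m deleted_mx g == row_of h *m C.
  by rewrite [deleted_mx g]g1 mulmx1.
rewrite deleted_mx_fixed // row_of_perm => /eqP/rowP/(_ (enum_rank z)).
rewrite !mxE enum_rankK.
have -> : (affine_perm g)^-1%g z = w.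
  by apply: (canLR (permK _)); rewrite affine_permE.
rewrite /h eqxx (negPf z_neq_w) -!(eq_sym x) (negPf x_neq_w) (negPf x_neq_z).
by rewrite !subr0 => /eqP; rewrite oner_eq0.
Qed.

Lemma deleted_group_isog : deleted_group \isog [set: AGL n F].
Proof. by rewrite isog_sym sub_isog // deleted_repr_inj. Qed.

(** Permutation matrices are orthogonal, so the dot product is preserved. *)
Lemma deleted_mx_gram g :
  deleted_mx g *m (B *m B^T) *m (deleted_mx g)^T = B *m B^T.
Proof.
rewrite mulmxA -mulmxA -trmx_mul deleted_mxE trmx_mul tr_perm_mx.
by rewrite mulmxA -(mulmxA B) -perm_mxM mulgV perm_mx1 mulmx1.
Qed.

(* Of a proper cycle and its complement, one has even size, and its indicator *)
(* function is a fixed vector.                                                *)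
Lemma deleted_mx_det0 g w0 w :
  w \notin porbit (affine_perm g) w0 -> \det (deleted_mx g - 1%:M) = 0.
Proof.
move=> w_notin; set s := affine_perm g in w_notin.
have [X [evenX sX [x Xx]]] : exists X : {set W},
    [/\ ~~ odd #|X|, forall y, (s y \in X) = (y \in X) & exists x, x \in X].
  have stabO y : (s y \in porbit s w0) = (y \in porbit s w0).
    rewrite -!eq_porbit_mem; congr (_ == _).
    by apply/eqP; rewrite eq_porbit_mem -{1}[s]expg1 mem_porbit.
  case odd_o: (odd #|porbit s w0|); last first.
    exists (porbit s w0); rewrite odd_o; split=> //.
    by exists w0; apply: porbit_id.
  exists (~: porbit s w0); split.
  - by rewrite -(addKb (odd #|porbit s w0|) (odd _)) -oddD cardsC oddW odd_o.
  - by move=> y; rewrite !inE stabO.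
  by exists w; rewrite inE.
pose v : 'rV['F_2]_#|{: W}| := row_of (fun y => (y \in X)%:R).
have sumv : v *m const_mx 1 = 0 :> 'M_1.
  rewrite row_of_mul1; under eq_bigr do rewrite mulrb.
  rewrite -big_mkcond sumr_const; apply/eqP.
  rewrite (_ : _%:R = 0) ?raddf0 //; apply/eqP.
  by rewrite -(dvdn_pcharf pchar_F2) dvdn2.
apply/eqP/det0P; exists (v *m C).
  apply/negP=> /eqP vC0; have := sum_zeroK sumB gramB cardW sumv.
  rewrite vC0 mul0mx => /rowP/(_ (enum_rank x))/eqP.
  by rewrite !mxE enum_rankK Xx.
apply/eqP; rewrite mulmxBr mulmx1 subr_eq0 deleted_mx_fixed // row_of_perm.
by apply/eqP/row_of_ext => y; rewrite -sX permKV.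
Qed.

(** For a nonzero submodule [U], the space [U *m BK] is invariant under the affine group and
    consists of sum-zero vectors, so it contains the rows of [BK]; multiplying by [CK] shows that
    [U] is everything. *)
Lemma deleted_group_irreducible p :
  p \in [pchar F] -> odd p -> absolutely_irreducible deleted_group.
Proof.
move=> charF odd_p; pose iota := F2_to_F2bar.
have charK : 2 \in [pchar F2bar] by rewrite (fmorph_pchar iota) pchar_F2.
have oddK k : odd k -> k%:R = 1 :> F2bar.
  move=> odd_k; rewrite -[k]odd_double_half odd_k natrD -mul2n natrM.
  by rewrite (pcharf0 charK) mul0r addr0.
have [|chi [chi0 chiD chi_neq1]] := @additive_character_exists F p F2bar charF.
  by rewrite oddK ?oner_neq0.
apply/mx_irrP; split=> // U /mxmoduleP stabU nzU.
pose BK := map_mx iota B; pose CK := map_mx iota C.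
have BCK : BK *m CK = 1%:M by rewrite -map_mxM sum_zero_coordK // map_mx1.
have sumBK : BK *m const_mx 1 = 0 :> 'cV_d.
  have := congr1 (map_mx iota) sumB; rewrite map_mxM map_const_mx rmorph1.
  by rewrite map_mx0.
suff: (BK <= U *m BK)%MS.
  case/submxP=> X eqB; rewrite -sub1mx; apply/submxP; exists X.
  by rewrite -[LHS]BCK [in LHS]eqB -!mulmxA BCK mulmx1.
apply/row_subP=> i.
apply: (affine_invariant_full chi0 chiD chi_neq1 (oddK _ oddW)).
- move=> g; rewrite -mulmxA.
  have -> : BK *m perm_mx_of g = map_mx iota (deleted_mx g) *m BK.
    by rewrite -map_mxM deleted_mxE map_mxM map_perm_mx.
  rewrite mulmxA submxMr //.
  by have := stabU (deleted_repr g); apply; apply/deleted_groupP; exists g.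
- by rewrite -mulmxA sumBK mulmx0.
- by apply: contraNneq nzU => UB0; rewrite -[U]mulmx1 -BCK mulmxA UB0 mul0mx.
by rewrite -row_mul sumBK row0.
Qed.

End DeletedPermutationModule.

(* Embedding into the given symplectic group *)
Local Close Scope ring_scope.

Theorem theorem1p6 (q n m : nat) (Fq : finFieldType)
    (f : {biscalar 'rV['F_2]_m.-1.+1}%R)
    (q_prime_power : prime_power q) (q_odd : odd q)
    (card_Fq : #|Fq| = q)
    (n_ge1 : 1 <= n) (m_def : m = q ^ n - 1)
    (n_q : 1 < n \/ n = 1 /\ ~~ prime q)
    (f_alt : alternating_form f) (f_nondeg : nondegenerate_form f) :
  exists G : {group {'GL_m(2)}},
    [/\ G \subset Sp f,
        fixed_point G,
        absolutely_irreducible G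
      & G \isog [set: AGL n Fq]].
Proof.
have [p [k [pr_p k_gt0 def_q]]] := q_prime_power.
have odd_p : odd p by move: q_odd; rewrite def_q oddX eqn0Ngt k_gt0.
have q_gt1 : 1 < q by rewrite def_q -(exp1n k) ltn_exp2r ?prime_gt1.
case: n => [//|n'] in n_ge1 m_def n_q *.
have kn_gt1 : 1 < k * n'.+1.
  case: n_q => [n_gt1 | [-> q_nprime]].
    exact: leq_trans n_gt1 (leq_pmull _ k_gt0).
  rewrite muln1; case: (k) k_gt0 def_q => [|[|//]] // _ def_q.
  by rewrite def_q expn1 pr_p in q_nprime.
(* Here [q ^ n >= 2], so [m > 0] and [m.-1.+2] is [m + 1]. *)
have cardW : #|{: 'rV[Fq]_n'.+1}| = m.-1.+2.
  rewrite card_mx mul1n card_Fq; have := ltn_expl n'.+1 q_gt1.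
  by rewrite m_def; case: (q ^ n'.+1) => [|[|N]] //; rewrite subn1.
have oddW : odd #|{: 'rV[Fq]_n'.+1}|.
  by rewrite card_mx mul1n card_Fq oddX q_odd orbT.
have [M fM] := biscalar_mxE f.
have altM : alternating_mx M.
  by move=> u; apply/matrixP=> i j; rewrite !ord1 -fM f_alt mxE.
have unitM : M \in unitmx.
  rewrite -row_free_unit -kermx_eq0; apply/rowV0P => u /sub_kermxP uM0.
  by apply: f_nondeg => v; rewrite fM uM0 mul0mx mxE.
(* Choosing the basis [B] with Gram matrix exactly [M] makes the dot product become [f] in
   coordinates. *)
have [B sumB gramB] := sum_zero_gram cardW oddW altM unitM.
rewrite -gramB in unitM.
exists (deleted_group sumB unitM cardW); split.
- apply/subsetP=> x /deleted_groupP[g ->]; rewrite inE.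
  have eqM := deleted_mx_gram sumB unitM cardW g; rewrite gramB in eqM.
  apply/forallP=> u; apply/forallP=> v; apply/eqP.
  by rewrite !fM -[in RHS]eqM trmx_mul !mulmxA.
- move=> x /deleted_groupP[g ->] /=.
  have card_pk := etrans card_Fq def_q.
  have [w] := affine_perm_not_transitive g pr_p odd_p card_pk kn_gt1.
  exact: deleted_mx_det0.
- apply: deleted_group_irreducible odd_p => //.
  exact: card_finPcharP (etrans card_Fq def_q) pr_p.
exact: deleted_group_isog.
Qed.
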